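(* Let $\epsilon$ be a desired positive constant. Denote by $M$, $N$ and $K$ the cardinalities of the sets $\mathcal C_-$, $\mathcal C_+$ and $\mathcal A$, respectively. The distributed auction algorithm described in the context terminates within $MN^2\lceil\Delta/\epsilon\rceil$ iterations, where $\Delta=\max\alpha_{ij}-\min\alpha_{ij}$.
   Context: $\mathcal C_-$ (clients), $\mathcal C_+$ (relays) and $\mathcal A$ (access points) are finite sets; $u$ is a virtual client and $v$ a virtual relay; $\mathcal C_-'=\mathcal C_-\cup\{u\}$, $\mathcal C_+'=\mathcal C_+\cup\{v\}$. Given utility weights $b_{ijk}$ and real numbers $\lambda_k$ ($i\in\mathcal C_-'$, $j\in\mathcal C_+'$, $k\in\mathcal A$), put $w_{ij}=2$ if $i\in\mathcal C_-$ and $j\in\mathcal C_+$, $w_{ij}=1$ otherwise, and define the benefits $\alpha_{ij}=\max_{k\in\mathcal A}(b_{ijk}-\lambda_k w_{ij})$, with $\alpha_{uv}=0$. For a client, being assigned to $v$ means connecting directly to its best access point; a relay assigned to $u$ assists no client. The algorithm is designed for the assignment problem: maximize $\sum_{i\in\mathcal C_-'}\sum_{j\in\mathcal C_+'}\alpha_{ij}\tilde z_{ij}$ subject to $\sum_{j\in\mathcal C_+'}\tilde z_{ij}=1$ for $i\in\mathcal C_-$, $\sum_{i\in\mathcal C_-'}\tilde z_{ij}=1$ for $j\in\mathcal C_+$, and $\tilde z_{ij}\ge0$ for $i\in\mathcal C_-'$, $j\in\mathcal C_+'$. Distributed auction algorithm with parameter $\epsilon$. Each client $i\in\mathcal C_-$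 stores its current partner $j_i$, initially $j_i=v$, and a local vector $P_i\in\mathbb R^N$ of relay prices (its $j$-th entry $[P_i]_j$ is the price of relay $j$ as known to client $i$), initially $P_i=\mathbf 0$; the virtual relay has price $[P_i]_v=0$. Each relay $j\in\mathcal C_+$ stores its price $p_j$, initially $p_j=\alpha_{uj}$, and its current client $i_j$, initially none. Client $i$ repeatedly does the following. (1) If it receives ''no'' and a new price $p_{j_i}$ from its current partner relay $j_i$, it disconnects from $j_i$, connects to its best access point, sets $[P_i]_{j_i}\leftarrow p_{j_i}$, and then $j_i\leftarrow v$. (2) If $j_i=v\neq\arg\max_{j\in\mathcal C_+'}\{\alpha_{ij}-[P_i]_j\}$, it sets $j_i'=\arg\max_{j\in\mathcal C_+'}\{\alpha_{ij}-[P_i]_j\}$, $\theta_i=\max_{j\in\mathcal C_+'}\{\alpha_{ij}-[P_i]_j\}$, $\omega_i=\max_{j\in\mathcal C_+',\,j\neq j_i'}\{\alpha_{ij}-[P_i]_j\}$ and $\beta_i=[P_i]_{j_i'}+\theta_i-\omega_i+\epsilon$, and sends a request with bid $\beta_i$ to relay $j_i'$. It receives a response (''yes'' or ''no'') together with a price $p'$. If the response is ''yes'', it connects to $j_i'$ and sets $j_i\leftarrow j_i'$. It then sets $[P_i]_{j_i'}\leftarrow p'$. Relay $j$, when it receives a request from a client $i$ with bid $\beta_i$: if $\beta_i-p_j\ge\epsilon$, it sends ''yes'' and $p_j$ to client $i$, sends ''no'' and $p_j$ to client $i_j$ (if any), connects to client $i$, and sets $i_j\leftarrow i$, $p_j\leftarrow\beta_i$;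 otherwise it sends ''no'' and $p_j$ to client $i$. The algorithm terminates when there are no client requests. *)

(* Defs.v *)
From mathcomp Require Import all_boot all_order all_algebra.
From mathcomp Require Import reals.

Set Implicit Arguments.
Unset Strict Implicit.
Unset Printing Implicit Defensive.

Import Order.TTheory GRing.Theory Num.Theory.
Local Open Scope ring_scope.

Section Extrema.
Variables (R : realType) (T : finType).
Implicit Types (P : pred T) (f : T -> R).

(* Both are 0, a junk value, when no element satisfies P. *)
Definition fmax P f : R :=
  let s := [seq f x | x in P] in \big[Num.max/head 0 s]_(y <- s) y.

Definition fmin P f : R :=
  let s := [seq f x | x in P] in \big[Num.min/head 0 s]_(y <- s) y.

Definition argmax f : pred T := [pred x | [forall y, f y <= f x]].

End Extrema.

Definition upd (S : eqType) (U : Type) (f : S -> U) x z : S -> U :=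
  fun x' => if x' == x then z else f x'.

Definition upd2 (S T : eqType) (U : Type) (f : S -> T -> U) x y z : S -> T -> U :=
  fun x' y' => if (x' == x) && (y' == y) then z else f x' y'.

Section Auction.
Variables (R : realType) (Client Relay : finType).

(* C_-' = option Client, where None is the virtual client u;
   C_+' = option Relay, where None is the virtual relay v. *)

Definition weight (i : option Client) (j : option Relay) : R :=
  if i && j then 2 else 1.

Definition benefit (AP : finType) (b : option Client -> option Relay -> AP -> R)
    (lambda : AP -> R) (i : option Client) (j : option Relay) : R :=
  if i || j then fmax predT (fun k => b i j k - lambda k * weight i j) else 0.

(* max alpha_ij - min alpha_ij over all of C_-' x C_+'. *)
Definition spread (alpha : option Client -> option Relay -> R) : R :=
  fmax predT (fun ij => alpha ij.1 ij.2) - fmin predT (fun ij => alpha ij.1 ij.2).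

Variant reply := Yes | No.

(* Clients and relays run asynchronously; the messages in transit are part of
   the global state. A client blocks until its request is answered, so it has
   at most one request in transit. Each relay-to-client link is a queue, oldest
   message first. *)
Record state := State {
  partner : Client -> option Relay;            (* j_i *)
  known_price : Client -> Relay -> R;          (* [P_i]_j *)
  awaiting : Client -> option Relay;           (* the relay i waits for *)
  request : Client -> option (Relay * R);      (* not yet handled: target, bid *)
  inbox : Client -> Relay -> seq (reply * R);  (* from relay to client *)
  price : Relay -> R;                          (* p_j *)
  holder : Relay -> option Client              (* i_j *)
}.

Variables (alpha : option Client -> option Relay -> R) (eps : R).

Definition init : state := {|
  partner := fun=> None;
  known_price := fun _ _ => 0;
  awaiting := fun=> None;
  request := fun=> None;
  inbox := fun _ _ => [::];
  price := fun j => alpha None (Some j);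
  holder := fun=> None
|}.

(* alpha_ij - [P_i]_j, with [P_i]_v = 0. *)
Definition value (s : state) (i : Client) (j : option Relay) : R :=
  alpha (Some i) j - (if j is Some j0 then known_price s i j0 else 0).

Definition bid (s : state) (i : Client) (j : Relay) : R :=
  let theta := fmax predT (value s i) in
  let omega := fmax (predC1 (Some j)) (value s i) in
  known_price s i j + theta - omega + eps.

(* The condition of step (2), "j_i = v <> argmax". The argmax is a set: when v
   ties with a relay, v is a maximizer and no request is sent. *)
Definition wants_request (s : state) (i : Client) : bool :=
  (partner s i == None) && (None \notin argmax (value s i)).

Definition deliver (ib : Client -> Relay -> seq (reply * R)) i j m :=
  upd2 ib i j (rcons (ib i j) m).

(* Step (2), first half: i sends a request to a maximizer j, any one of them
   if there are several. *)
Definition send_request (s : state) (i : Client) (j : Relay) : state := {|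
  partner := partner s;
  known_price := known_price s;
  awaiting := upd (awaiting s) i (Some j);
  request := upd (request s) i (Some (j, bid s i j));
  inbox := inbox s;
  price := price s;
  holder := holder s
|}.

(* Relay j handles a request of client i with bid beta. All the replies carry
   the price p_j from before its update to beta. *)
Definition handle_request (s : state) (i : Client) (j : Relay) (beta : R) : state :=
  let accept := eps <= beta - price s j in
  let answered := deliver (inbox s) i j (if accept then Yes else No, price s j) in
  {|
    partner := partner s;
    known_price := known_price s;
    awaiting := awaiting s;
    request := upd (request s) i None;
    inbox := if accept then
               if holder s j is Some i0 then deliver answered i0 j (No, price s j)
               else answered
             else answered;
    price := if accept then upd (price s) j beta else price s;
    holder := if accept then upd (holder s) j (Some i) else holder s
  |}.

(* Step (2), second half: i receives the response (r, p) of relay j. *)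
Definition receive_response (s : state) (i : Client) (j : Relay)
    (r : reply) (p : R) : state := {|
  partner := if r is Yes then upd (partner s) i (Some j) else partner s;
  known_price := upd2 (known_price s) i j p;
  awaiting := upd (awaiting s) i None;
  request := request s;
  inbox := upd2 (inbox s) i j (behead (inbox s i j));
  price := price s;
  holder := holder s
|}.

(* Step (1): i receives "no" and p from its current partner j. *)
Definition disconnect (s : state) (i : Client) (j : Relay) (p : R) : state := {|
  partner := upd (partner s) i None;
  known_price := upd2 (known_price s) i j p;
  awaiting := awaiting s;
  request := request s;
  inbox := upd2 (inbox s) i j (behead (inbox s i j));
  price := price s;
  holder := holder s
|}.

(* The boolean label is true on the transitions that start an iteration, i.e.
   on which some client sends a request. *)
Inductive step (s : state) : bool -> state -> Prop :=
| StepRequest i j :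
    awaiting s i = None -> wants_request s i -> Some j \in argmax (value s i) ->
    step s true (send_request s i j)
| StepHandle i j beta :
    request s i = Some (j, beta) ->
    step s false (handle_request s i j beta)
| StepResponse i j r p q :
    awaiting s i = Some j -> inbox s i j = (r, p) :: q ->
    step s false (receive_response s i j r p)
| StepDisconnect i j p q :
    awaiting s i = None -> partner s i = Some j -> inbox s i j = (No, p) :: q ->
    step s false (disconnect s i j p).

(* A maximal execution, from the initial state and with any interleaving; it
   stutters once no transition is possible. *)
Definition execution (sigma : nat -> state) (starts : nat -> bool) : Prop :=
  sigma 0%N = init /\
  forall t, step (sigma t) (starts t) (sigma t.+1) \/
    [/\ forall l s', ~ step (sigma t) l s', starts t = false
      & sigma t.+1 = sigma t].

(* No client request is pending, and none can arise: no message is in transit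
   and no client satisfies the condition of step (2). *)
Definition terminated (s : state) : Prop :=
  forall i, [/\ awaiting s i = None, request s i = None,
                forall j, inbox s i j = [::] & ~~ wants_request s i].

End Auction.

(* Main.v *)
(* Each completed request of client i to relay j raises the price of j known to
   i: by a positive amount the first time, since it starts at 0 and bids exceed
   it by at least eps, and by at least eps afterwards, since it is then a past
   price of j, and distinct prices of j differ by at least eps. A request needs
   [P_i]_j < alpha_ij - alpha_iv <= Delta, so with c = ceil (Delta / eps) at most
   c + 1 requests go from i to j, which is at most N * c when N >= 2. When
   N = 1 every bid is at least alpha_ij - alpha_iv + eps, so that i sends at
   most one request. A finite number of requests gives a finite run, because
   each of them causes at most three further transitions. *)

Require Import Defs.
From mathcomp Require Import all_boot all_order all_algebra.
From mathcomp Require Import reals.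
From mathcomp Require Import zify lra.

Set Implicit Arguments.
Unset Strict Implicit.
Unset Printing Implicit Defensive.

Import Order.TTheory GRing.Theory Num.Theory.
Local Open Scope ring_scope.

(** * Extrema over finite types *)

Section Extrema.
Context {R : realType} {T : finType}.
Implicit Types (P : pred T) (f : T -> R).

Lemma fmax_ge P f x : P x -> f x <= fmax P f.
Proof.
move=> Px; rewrite /fmax; apply: (@le_bigmax_seq _ _ _ _ _ (f x) xpredT id) => //.
exact: image_f.
Qed.

Lemma fmin_le P f x : P x -> fmin P f <= f x.
Proof.
move=> Px; rewrite /fmin; apply: (@ge_bigmin_seq _ _ _ _ _ (f x) xpredT id) => //.
exact: image_f.
Qed.

(** The witness [x] excludes an empty range, on which [fmax] is the junk value 0. *)
Lemma fmax_le P f x m : P x -> (forall y, P y -> f y <= m) -> fmax P f <= m.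
Proof.
move=> Px fm; rewrite /fmax.
have sm y : y \in [seq f x | x in P] -> y <= m by move=> /imageP[z Pz ->]; exact: fm.
have : f x \in [seq f x | x in P] by exact: image_f.
case: [seq f x | x in P] sm => // y s sm _ /=.
by rewrite big_seq; apply: bigmax_le => //; exact/sm/mem_head.
Qed.

Lemma argmax_ge f x y : x \in argmax f -> f y <= f x.
Proof. by move=> /forallP. Qed.

Lemma notin_argmax_lt f x y : x \in argmax f -> y \notin argmax f -> f y < f x.
Proof.
move=> xmax /forallPn[z]; rewrite -ltNge => /lt_le_trans; apply; exact: argmax_ge.
Qed.

Lemma argmax_neq0 f (x0 : T) : exists x, x \in argmax f.
Proof.
have [x _ xmax] := @arg_maxP _ _ T x0 xpredT f isT.
by exists x; apply/forallP => y; exact: xmax.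
Qed.

End Extrema.

(** * Point updates and their effect on sums *)

Lemma updE (S : eqType) U (f : S -> U) x z : upd f x z x = z.
Proof. by rewrite /upd eqxx. Qed.

Lemma upd_neq (S : eqType) U (f : S -> U) x z y : y != x -> upd f x z y = f y.
Proof. by rewrite /upd => /negbTE->. Qed.

Lemma upd2E (S T : eqType) U (f : S -> T -> U) x y z : upd2 f x y z x y = z.
Proof. by rewrite /upd2 !eqxx. Qed.

Lemma upd2_neql (S T : eqType) U (f : S -> T -> U) x y z x' y' :
  x' != x -> upd2 f x y z x' y' = f x' y'.
Proof. by rewrite /upd2 => /negbTE->. Qed.

Lemma upd2_neqr (S T : eqType) U (f : S -> T -> U) x y z x' y' :
  y' != y -> upd2 f x y z x' y' = f x' y'.
Proof. by rewrite /upd2 => /negbTE->; rewrite andbF. Qed.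

Lemma sum_upd (S : finType) U (F : U -> nat) (f : S -> U) x z :
  (\sum_i F (upd f x z i) + F (f x) = \sum_i F (f i) + F z)%N.
Proof.
rewrite (bigD1 x) //= [in RHS](bigD1 x) //= updE.
rewrite (eq_bigr (fun i => F (f i))); first by lia.
by move=> i ix; rewrite upd_neq.
Qed.

Lemma sum_upd2 (S T : finType) U (F : U -> nat) (f : S -> T -> U) x y z :
  (\sum_i \sum_j F (upd2 f x y z i j) + F (f x y) = \sum_i \sum_j F (f i j) + F z)%N.
Proof.
have row := sum_upd F (f x) y z.
rewrite (bigD1 x) //= [in RHS](bigD1 x) //=.
have -> : (\sum_j F (upd2 f x y z x j) = \sum_j F (upd (f x) y z j))%N.
  by apply: eq_bigr => j _; rewrite /upd2 /upd eqxx.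
rewrite (eq_bigr (fun i => \sum_j F (f i j))%N); first by lia.
by move=> i ix; apply: eq_bigr => j _; rewrite upd2_neql.
Qed.

Section Auction.
Context {R : realType} {Client Relay : finType}.
Variables (alpha : option Client -> option Relay -> R) (eps : R).
Hypothesis eps_gt0 : 0 < eps.

Local Notation state := (state R Client Relay).
Local Notation step := (step alpha eps).
Implicit Types (s : state) (i : Client) (j : Relay) (r : Client -> Relay -> nat).

(** * Bounds on bids and on the spread *)

Lemma bid_ge s i j : Some j \in argmax (value alpha s i) ->
  known_price s i j + eps <= bid alpha eps s i j.
Proof.
move=> jmax; rewrite /bid.
suff : fmax (predC1 (Some j)) (value alpha s i) <= fmax predT (value alpha s i) by lra.
(* The virtual relay always competes with [Some j], so [omega] is a genuine maximum. *)
by apply: (@fmax_le _ _ _ _ None) => // y _; exact: fmax_ge.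
Qed.

(** The only rival of a sole relay is [v]; the known price then cancels between [theta] and the
    bid. *)
Lemma bid_ge1 s i j : #|Relay| = 1%N ->
  alpha (Some i) (Some j) - alpha (Some i) None + eps <= bid alpha eps s i j.
Proof.
move=> R1; rewrite /bid.
have : value alpha s i (Some j) <= fmax predT (value alpha s i) by exact: fmax_ge.
suff : fmax (predC1 (Some j)) (value alpha s i) <= value alpha s i None.
  by rewrite /value /=; lra.
apply: (@fmax_le _ _ _ _ None) => // -[k|//] /= kj.
by rewrite (fintype_le1P _ j k) ?R1 ?eqxx in kj.
Qed.

Lemma spread_ge a b c d : alpha a b - alpha c d <= spread alpha.
Proof.
apply: lerB; first exact: (@fmax_ge _ _ predT (fun ij => alpha ij.1 ij.2) (a, b)).
exact: (@fmin_le _ _ predT (fun ij => alpha ij.1 ij.2) (c, d)).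
Qed.

(** * The invariant *)

(* Lower bound on [P_i]_j once i has completed n requests to j. *)
Definition reached i j n (x : R) : Prop :=
  if n is n'.+1 then
    n'%:R * eps < x /\
    (#|Relay| = 1%N -> alpha (Some i) (Some j) - alpha (Some i) None < x)
  else 0 <= x.

(* x is the present price of j or one of its past prices. *)
Definition charged s j (x : R) : Prop := x = price s j \/ x + eps <= price s j.

(** Here [r i j] is a ghost counter of the requests sent by [i] to [j]. Before the first one
    [charged] may fail, because the initial known price 0 is unrelated to the initial price of
    [j]. *)
Definition settled s r i j : Prop :=
  [/\ reached i j (r i j) (known_price s i j),
      (0 < r i j)%N -> charged s j (known_price s i j),
      inbox s i j = [::] & holder s j <> Some i].

(** An acceptance in transit is included because a relay may displace a client before its [Yes] has
    arrived. *)
Definition connection s i j (q : seq (reply * R)) : Prop :=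
  [/\ partner s i = Some j, awaiting s i = None & q = [::]] \/
  [/\ partner s i = None, awaiting s i = Some j & exists p, q = [:: (Yes, p)]].

(** The phases of an exchange. In [Requesting] the counter already includes the pending request,
    hence the shift from [n.+1] to [n]. In [Holding] the bound concerns [price s j], the client's
    own bid: a [Yes] carries the older price, and the bid comes back only with the [No] of a
    displacement. *)
Variant engaged s r i j : Prop :=
| Requesting n beta of
    partner s i = None & awaiting s i = Some j & request s i = Some (j, beta) &
    inbox s i j = [::] & holder s j <> Some i &
    r i j = n.+1 & reached i j n (known_price s i j) &
    ((0 < n)%N -> charged s j (known_price s i j)) &
    known_price s i j + eps <= beta &
    (#|Relay| = 1%N -> alpha (Some i) (Some j) - alpha (Some i) None + eps <= beta)
| Refused p of
    partner s i = None & awaiting s i = Some j & request s i = None &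
    inbox s i j = [:: (No, p)] & holder s j <> Some i &
    reached i j (r i j) p & charged s j p
| Holding of
    connection s i j (inbox s i j) & request s i = None & holder s j = Some i &
    reached i j (r i j) (price s j)
| Displaced q p of
    connection s i j q & request s i = None & inbox s i j = rcons q (No, p) &
    holder s j <> Some i & reached i j (r i j) p & charged s j p.

Variant consistent s r i : Prop :=
| Idle of partner s i = None & awaiting s i = None & request s i = None &
    (forall j, settled s r i j)
| Active j of (forall j', j' != j -> settled s r i j') & engaged s r i j.

Definition cap : nat := (#|Relay| * `|Num.ceil (spread alpha / eps)|)%N.

Definition invariant s r : Prop :=
  (forall i, consistent s r i) /\ forall i j, (r i j <= cap)%N.

(** * Stability under changes elsewhere *)

(** Changes at [j] that leave the phase of [i] intact. A displacement of [i] is left out, since it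
    turns [Holding] into [Displaced]. *)
Definition evolves s s' i j : Prop :=
  (price s' j = price s j /\ (holder s' j = Some i <-> holder s j = Some i)) \/
  [/\ price s j + eps <= price s' j, holder s j <> Some i & holder s' j <> Some i].

Lemma evolves_charged {s s' i j x} : evolves s s' i j -> charged s j x -> charged s' j x.
Proof.
by have := eps_gt0; rewrite /charged => ? -[[-> _]//|[pp _ _] [->|xp]]; right; lra.
Qed.

Lemma evolves_holder {s s' i j} : evolves s s' i j ->
  holder s j <> Some i -> holder s' j <> Some i.
Proof. by move=> [[_ hh]|[_ _ hh]] h // /hh. Qed.

Lemma settled_frame s s' r r' i j : evolves s s' i j ->
  known_price s' i j = known_price s i j -> inbox s' i j = inbox s i j ->
  r' i j = r i j -> settled s r i j -> settled s' r' i j.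
Proof.
move=> ev kE iE rE [re ch ib ho]; split; rewrite ?kE ?iE ?rE //.
  by move=> /ch /(evolves_charged ev).
exact: (evolves_holder ev).
Qed.

Lemma consistent_frame s s' r r' i : (forall j, evolves s s' i j) ->
  partner s' i = partner s i -> awaiting s' i = awaiting s i ->
  request s' i = request s i -> known_price s' i =1 known_price s i ->
  inbox s' i =1 inbox s i -> r' i =1 r i -> consistent s r i -> consistent s' r' i.
Proof.
move=> ev pE aE qE kE iE rE.
have fr j : settled s r i j -> settled s' r' i j by exact: settled_frame.
have cE j q : connection s i j q -> connection s' i j q by rewrite /connection pE aE.
case=> [p a q st|j st en].
  by apply: Idle; rewrite ?pE ?aE ?qE // => j; exact/fr/st.
apply: (@Active _ _ _ j) => [j' /st/fr //|].
case: en.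
- move=> n beta p a q ib ho rn re ch kb k1.
  apply: (@Requesting _ _ _ _ n beta); rewrite ?pE ?aE ?qE ?kE ?iE ?rE //.
    exact: (evolves_holder (ev j)).
  by move=> /ch /(evolves_charged (ev j)).
- move=> p pa a q ib ho re ch.
  apply: (@Refused _ _ _ _ p); rewrite ?pE ?aE ?qE ?iE ?rE //.
    exact: (evolves_holder (ev j)).
  exact: (evolves_charged (ev j)).
- move=> co q ho re; case: (ev j) => [[prE hoE]|[_ /(_ ho)//]].
  apply: Holding; rewrite ?qE ?prE ?iE ?rE //; first exact: cE.
  exact/hoE.
- move=> m p co q ib ho re ch.
  apply: (@Displaced _ _ _ _ m p); rewrite ?qE ?iE ?rE //.
  + exact: cE.
  + exact: (evolves_holder (ev j)).
  + exact: (evolves_charged (ev j)).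
Qed.

Lemma evolves_refl s s' i j : price s' j = price s j -> holder s' j = holder s j ->
  evolves s s' i j.
Proof. by move=> pE hE; left; rewrite hE. Qed.

(** * Growth of known prices and the bound on requests *)

Lemma reached_bid i j n x y : reached i j n x -> x + eps <= y ->
  (#|Relay| = 1%N -> alpha (Some i) (Some j) - alpha (Some i) None < y) ->
  reached i j n.+1 y.
Proof.
have e0 := eps_gt0; case: n => [|n] /=; first by move=> x0 xy y1; split=> //; lra.
move=> [nx _] xy y1; split=> //.
by move: nx; rewrite -natr1 mulrDl mul1r; lra.
Qed.

(** A refused bid is at least [x + eps], so a charged [x] is not the current price and lies at least
    [eps] below it. On a first request only [x < price s j] follows, which is all that count 1
    demands. *)
Lemma reached_refusal s i j n x beta : reached i j n x ->
  ((0 < n)%N -> charged s j x) -> x + eps <= beta ->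
  (#|Relay| = 1%N -> alpha (Some i) (Some j) - alpha (Some i) None + eps <= beta) ->
  beta - price s j < eps -> reached i j n.+1 (price s j).
Proof.
have e0 := eps_gt0; case: n => [|n] re ch xb b1 rj.
  by split; [move: re => /=; lra|move=> /b1; lra].
apply: reached_bid re _ _; last by move=> /b1; lra.
by case: (ch isT) => // xE; lra.
Qed.

Lemma request_le_cap s r i j : reached i j (r i j) (known_price s i j) ->
  wants_request alpha s i -> Some j \in argmax (value alpha s i) ->
  (r i j < cap)%N.
Proof.
have e0 := eps_gt0; move=> re /andP[_ Nmax] jmax.
have := notin_argmax_lt jmax Nmax; rewrite /value subr0 => lt.
have sp := spread_ge (Some i) (Some j) (Some i) None.
have N_gt0 : (0 < #|Relay|)%N by apply/card_gt0P; exists j.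
set c := Num.ceil (spread alpha / eps).
have lec : spread alpha / eps <= c%:~R by rewrite Num.Theory.ceil_ge.
have k_ge0 : 0 <= known_price s i j.
  case: (r i j) re => //= n [nk _]; apply/ltW/le_lt_trans/nk.
  by rewrite mulr_ge0 // ltW.
have c_gt0 : 0 < c.
  rewrite -(ltr0z R); apply: lt_le_trans lec.
  by rewrite divr_gt0 //; lra.
rewrite /cap -/c; case: (r i j) re => [_|n [nk R1]].
  by rewrite muln_gt0 N_gt0 absz_gt0 gt_eqF.
have nc : n%:Z < c.
  rewrite -(ltr_int R); apply: lt_le_trans lec.
  by rewrite ltr_pdivlMr //; move: nk; rewrite /=; lra.
(* With a sole relay, [reached] contradicts the strict preference for [j] over [v]. *)
have N2 : (1 < #|Relay|)%N.
  by rewrite ltn_neqAle N_gt0 andbT; apply/eqP => /esym /R1; lra.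
(* The bounds give [n.+1 <= c < N * c], as [c] is positive and there are at least two relays. *)
by nia.
Qed.

(** * Recovering the phase of a client *)

Lemma idle_facts s r i : partner s i = None -> awaiting s i = None ->
  consistent s r i -> request s i = None /\ forall j, settled s r i j.
Proof.
move=> p a [_ _ q st|j _ en]; first by split.
by case: en => [n beta _|m _|[[]|[_]]|q m [[]|[_]]]; rewrite ?p ?a.
Qed.

Lemma engaged_awaiting s r i j : awaiting s i = Some j -> consistent s r i ->
  (forall j', j' != j -> settled s r i j') /\ engaged s r i j.
Proof.
move=> a [|j' st en]; first by rewrite a.
suff -> : j = j' by [].
by case: en => [n beta _|m _|[[_]|[_]]|q m [[_]|[_]]]; rewrite a // => -[].
Qed.

Lemma engaged_partner s r i j : partner s i = Some j -> consistent s r i ->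
  (forall j', j' != j -> settled s r i j') /\ engaged s r i j.
Proof.
move=> p [|j' st en]; first by rewrite p.
suff -> : j = j' by [].
by case: en => [n beta|m|[[]|[]]|q m [[]|[]]]; rewrite p // => -[].
Qed.

(** Every alternative to [Holding] records that [j] does not hold [i]. *)
Lemma engaged_holder s r i j : holder s j = Some i -> consistent s r i ->
  (forall j', j' != j -> settled s r i j') /\
  [/\ connection s i j (inbox s i j), request s i = None &
      reached i j (r i j) (price s j)].
Proof.
move=> ho [_ _ _ /(_ j)[]//|j' st en].
have [jj'|/st[]//] := eqVneq j j'.
by rewrite -jj' in st en; case: en.
Qed.

(** * Preservation of the invariant by each transition *)

Lemma send_request_invariant s r i j : awaiting s i = None ->
  wants_request alpha s i -> Some j \in argmax (value alpha s i) ->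
  invariant s r ->
  invariant (send_request alpha eps s i j) (upd2 r i j (r i j).+1).
Proof.
move=> a w jmax [co rcap].
have p : partner s i = None by case/andP: w => /eqP.
have [q st] := idle_facts p a (co i).
have [re ch ib ho] := st j.
split=> [i'|i' j']; last first.
  have [->|ii'] := eqVneq i' i; last by rewrite upd2_neql.
  have [->|jj'] := eqVneq j' j; last by rewrite upd2_neqr.
  by rewrite upd2E; exact: request_le_cap re w jmax.
have [->|ii'] := eqVneq i' i; last first.
  apply: consistent_frame (co i') => //=; rewrite ?upd_neq //.
  - by move=> j'; exact: evolves_refl.
  - by move=> j'; rewrite upd2_neql.
apply: (@Active _ _ _ j) => [j' jj'|].
  apply: settled_frame (st j') => //; last by rewrite upd2_neqr.
  exact: evolves_refl.
apply: (@Requesting _ _ _ _ (r i j) (bid alpha eps s i j)) => //=;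
  rewrite ?updE ?upd2E //.
- exact: bid_ge.
- exact: bid_ge1.
Qed.

Lemma handle_request_invariant s r i j beta : request s i = Some (j, beta) ->
  invariant s r -> invariant (handle_request eps s i j beta) r.
Proof.
move=> q [co rcap]; split=> // i'.
(* A request in transit forces the phase [Requesting]. *)
have [st [n [[p a ib ho] [rn re ch kb k1]]]] :
    (forall j', j' != j -> settled s r i j') /\
    exists n, [/\ partner s i = None, awaiting s i = Some j, inbox s i j = [::] &
      holder s j <> Some i] /\
    [/\ r i j = n.+1, reached i j n (known_price s i j),
      (0 < n)%N -> charged s j (known_price s i j), known_price s i j + eps <= beta &
      #|Relay| = 1%N -> alpha (Some i) (Some j) - alpha (Some i) None + eps <= beta].
  case: (co i) => [_ _|j' st []]; rewrite q // => n b p a [-> ->] *.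
  by split=> //; exists n.
have e0 := eps_gt0.
rewrite /handle_request; have [acc|rej] := lerP eps (beta - price s j); last first.
  have [->|ii'] := eqVneq i' i; last first.
    apply: consistent_frame (co i') => //=; rewrite ?upd_neq //.
    - by move=> j'; exact: evolves_refl.
    - by move=> j'; rewrite /deliver upd2_neql.
  apply: (@Active _ _ _ j) => [j' jj'|].
    apply: settled_frame (st _ jj') => //; last by rewrite /= /deliver upd2_neqr.
    exact: evolves_refl.
  apply: (@Refused _ _ _ _ (price s j)) => //=; rewrite ?updE /deliver ?upd2E ?ib //.
  - by rewrite rn; apply: reached_refusal re ch kb k1 rej.
  - by left.
have evn s' i2 j' : price s' = upd (price s) j beta ->
    holder s' = upd (holder s) j (Some i) -> j' != j -> evolves s s' i2 j'.
  by move=> pE hE jj'; apply: evolves_refl; rewrite ?pE ?hE upd_neq.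
have [->|ii'] := eqVneq i' i.
  apply: (@Active _ _ _ j) => [j' jj'|].
    apply: settled_frame (st _ jj') => //=; first exact: evn.
    by case: (holder s j) => [i0|]; rewrite /deliver !upd2_neqr.
  apply: Holding => /=; rewrite ?updE //.
  - right; split=> //=; exists (price s j).
    (* The previous holder is not [i], so its [No] goes to another inbox. *)
    case hE: (holder s j) ho => [i0|] ho; last by rewrite /deliver upd2E ib.
    rewrite /deliver upd2_neql ?upd2E ?ib //.
    by apply: contra_notN ho => /eqP->.
  - rewrite rn; apply: reached_bid re kb _ => /k1; lra.
(* The displaced client is sent the price before the update, for which [Holding] kept the bound. *)
have [hi'|hi'] := eqVneq (holder s j) (Some i').
  have [st' [cn' q' re']] := engaged_holder hi' (co i').
  apply: (@Active _ _ _ j) => [j' jj'|].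
    apply: settled_frame (st' _ jj') => //=; first exact: evn.
    by rewrite hi' /deliver !upd2_neqr.
  apply: (@Displaced _ _ _ _ (inbox s i' j) (price s j)) => //=.
  - by rewrite upd_neq.
  - by rewrite hi' /deliver upd2E upd2_neql.
  - by rewrite updE => -[ii]; rewrite ii eqxx in ii'.
  - by right; rewrite /= updE; lra.
apply: consistent_frame (co i') => //=; rewrite ?upd_neq //.
- move=> j'; have [->|] := eqVneq j' j; last exact: evn.
  right; rewrite /= !updE; split; [lra|exact/eqP|].
  by move=> [ii]; rewrite ii eqxx in ii'.
- move=> j'; case: (holder s j) hi' => [i0|] hi'; rewrite /deliver ?upd2_neql //.
  by apply: contraNneq hi' => ->.
Qed.

(** [Refused] leads to [Idle], [Holding] keeps its phase with an emptied queue, and [Displaced]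
    keeps its phase with the [No] still to be read. *)
Lemma receive_response_invariant s r i j m p q : awaiting s i = Some j ->
  inbox s i j = (m, p) :: q -> invariant s r ->
  invariant (receive_response s i j m p) r.
Proof.
move=> a ib [co rcap]; split=> // i'.
have [->|ii'] := eqVneq i' i; last first.
  apply: consistent_frame (co i') => //=; rewrite ?upd_neq //.
  - by move=> j'; exact: evolves_refl.
  - by case: m {ib}; rewrite ?upd_neq.
  - by move=> j'; rewrite upd2_neql.
  - by move=> j'; rewrite upd2_neql.
have [st en] := engaged_awaiting a (co i).
have st' j' : j' != j -> settled (receive_response s i j m p) r i j'.
  move=> jj'; apply: settled_frame (st _ jj') => //=; rewrite ?upd2_neqr //.
  exact: evolves_refl.
case: en => [n beta _ _ _|p' pa _ qe|cn qe ho re|q' p' cn qe].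
- by rewrite ib.
- rewrite ib => -[mE pE qE] ho re ch; subst m p q.
  apply: Idle => //=; rewrite ?updE // => j'.
  have [->|] := eqVneq j' j; last exact: st'.
  by split; rewrite /= ?upd2E ?ib.
- move: cn; rewrite ib => -[[]|[pa _ [p' [mE pE qE]]]]; first by rewrite a.
  subst m p q.
  apply: (@Active _ _ _ j) => //; apply: Holding => //=.
  by left; rewrite /= ?updE ?upd2E ib.
- case: cn => [[]|[pa _ [p0 ->]]]; first by rewrite a.
  rewrite ib => -[mE pE qE] ho re ch; subst m p q.
  apply: (@Active _ _ _ j) => //; apply: (@Displaced _ _ _ _ [::] p') => //=.
  + by left; rewrite /= ?updE.
  + by rewrite upd2E ib.
Qed.

(** A connected client finds a [No] only when [Displaced], and that message is the last of its
    queue. *)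
Lemma disconnect_invariant s r i j p q : awaiting s i = None ->
  partner s i = Some j -> inbox s i j = (No, p) :: q -> invariant s r ->
  invariant (disconnect s i j p) r.
Proof.
move=> a pa ib [co rcap]; split=> // i'.
have [->|ii'] := eqVneq i' i; last first.
  apply: consistent_frame (co i') => //=; rewrite ?upd_neq //.
  - by move=> j'; exact: evolves_refl.
  - by move=> j'; rewrite upd2_neql.
  - by move=> j'; rewrite upd2_neql.
have [st en] := engaged_partner pa (co i).
case: en => [n beta|p'|cn qe ho re|q' p' cn qe]; rewrite ?pa ?a //.
  by case: cn; rewrite pa ib => -[].
case: cn => [[_ _ ->]|[]]; last by rewrite pa.
rewrite ib => -[pE qE] ho re ch; subst p q.
apply: Idle => //=; rewrite ?updE // => j'.
have [->|jj'] := eqVneq j' j; first by split; rewrite /= ?upd2E ?ib.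
apply: settled_frame (st _ jj') => //=; rewrite ?upd2_neqr //.
exact: evolves_refl.
Qed.

Lemma init_invariant : invariant (init alpha) (fun _ _ => 0%N).
Proof. by split=> // i; apply: Idle => // j; split=> //=. Qed.

(** The counter grows exactly on labelled transitions, which ties its total to the number of
    iterations. *)
Lemma step_invariant s l s' r : step s l s' -> invariant s r ->
  exists2 r', invariant s' r' &
    (\sum_i \sum_j r' i j = \sum_i \sum_j r i j + l)%N.
Proof.
case=> [i j a w jmax|i j beta q|i j m p q a ib|i j p q a pa ib] inv.
- exists (upd2 r i j (r i j).+1); first exact: send_request_invariant.
  by have := sum_upd2 id r i j (r i j).+1; rewrite /=; lia.
- by exists r; [exact: handle_request_invariant|rewrite addn0].
- by exists r; [exact: (@receive_response_invariant _ _ _ _ _ _ q)|rewrite addn0].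
- by exists r; [exact: (@disconnect_invariant _ _ _ _ _ q)|rewrite addn0].
Qed.

(** * Messages in transit and absence of deadlock *)

(* A request weighs 3 because handling it produces up to two messages. *)
Definition load s : nat :=
  (\sum_i 3 * request s i + \sum_i \sum_j size (inbox s i j))%N.

Lemma load_init : load (init alpha) = 0%N.
Proof. by rewrite /load big1 // big1 // => i _; rewrite big1. Qed.

(** Sending a request adds 3, handling one removes 3 and adds at most 2, and a reception removes
    1. *)
Lemma step_load s l s' : step s l s' -> (load s' < load s + 4 * l)%N.
Proof.
have behead_load i j x q : inbox s i j = x :: q ->
    (\sum_i' \sum_j' size (upd2 (inbox s) i j (behead (inbox s i j)) i' j') <
     \sum_i' \sum_j' size (inbox s i' j'))%N.
  by move=> ib; have := sum_upd2 size (inbox s) i j q; rewrite ib /=; lia.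
have deliver_load (ib : Client -> Relay -> seq (reply * R)) i j x :
    (\sum_i' \sum_j' size (deliver ib i j x i' j') =
     (\sum_i' \sum_j' size (ib i' j')).+1)%N.
  by have := sum_upd2 size ib i j (rcons (ib i j) x); rewrite size_rcons /deliver; lia.
have request_load i z := sum_upd (fun x : option (Relay * R) => 3 * x)%N (request s) i z.
case=> [i j a w jmax|i j beta q|i j m p q a /behead_load|i j p q a pa /behead_load];
  rewrite /load /=; try by lia.
- by have /= := request_load i (Some (j, bid alpha eps s i j)); lia.
- have /= := request_load i None; rewrite q /=.
  by case: ifP; case: (holder s j) => [i0|]; rewrite !deliver_load; lia.
Qed.

(** Every engaged phase enables a transition, except an established connection with an empty
    queue. *)
Lemma stuck_terminated s r : invariant s r -> (forall l s', ~ step s l s') ->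
  terminated alpha s.
Proof.
move=> [co _] stuck i.
have q : request s i = None.
  by case qE: (request s i) => [[j beta]|//]; case: (stuck _ _ (StepHandle _ _ qE)).
have nresp j x : awaiting s i = Some j -> inbox s i j <> x :: behead (inbox s i j).
  by case: x => m p a ib; case: (stuck _ _ (StepResponse _ _ a ib)).
have ndisc j p : awaiting s i = None -> partner s i = Some j ->
    inbox s i j <> (No, p) :: behead (inbox s i j).
  by move=> a pa ib; case: (stuck _ _ (StepDisconnect _ _ a pa ib)).
have nwants : awaiting s i = None -> ~~ wants_request alpha s i.
  move=> a; apply/negP => w; have [[j|] jmax] := argmax_neq0 (value alpha s i) None.
    exact: (stuck _ _ (StepRequest _ a w jmax)).
  by case/andP: w; rewrite jmax.
case: (co i) => [pa a _ st|j st en].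
  by split; [| |move=> j; case: (st j)|exact: nwants].
have stib j' : j' != j -> inbox s i j' = [::] by move=> /st[].
case: en => [n beta _ _|p pa a _ ib|cn _ _ _|q' p cn _ ib].
- by rewrite q.
- by case: (nresp j (No, p) a); rewrite ib.
- case: cn => [[pa a ib]|[pa a [p ib]]]; last by case: (nresp j (Yes, p) a); rewrite ib.
  split=> //; last exact: nwants.
  by move=> j'; have [->|/stib] := eqVneq j' j.
- case: cn => [[pa a qE]|[pa a [p' qE]]].
    by case: (ndisc j p a pa); rewrite ib qE.
  by case: (nresp j (Yes, p') a); rewrite ib qE.
Qed.

(** * Bounds along an execution *)

Section Execution.
Variables (sigma : nat -> state) (starts : nat -> bool).
Hypothesis run : execution alpha eps sigma starts.

Lemma execution_invariant t : exists2 r, invariant (sigma t) r &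
  (\sum_i \sum_j r i j = \sum_(t' < t) starts t')%N.
Proof.
elim: t => [|t [r inv rE]].
  exists (fun _ _ => 0%N); first by case: run => -> _; exact: init_invariant.
  by rewrite big_ord0 big1 // => i _; rewrite big1.
rewrite big_ord_recr /=; case: run => _ /(_ t)[st|[_ -> ->]].
  by have [r' inv' r'E] := step_invariant st inv; exists r' => //; rewrite r'E rE.
by exists r => //; rewrite addn0.
Qed.

Lemma execution_starts_le t :
  (\sum_(t' < t) starts t' <= #|Client| * (#|Relay| * cap))%N.
Proof.
have [r [_ rcap] <-] := execution_invariant t.
rewrite -!sum_nat_const; apply: leq_sum => i _.
exact: leq_sum.
Qed.

(** Telescoping [step_load]: until the run is stuck, each request pays for four units of time. *)
Lemma execution_load t : (exists T, forall l s', ~ step (sigma T) l s') \/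
  (t + load (sigma t) <= 4 * \sum_(t' < t) starts t')%N.
Proof.
elim: t => [|t [|IH]]; last 1 first.
- case: run => _ /(_ t)[/step_load st|[stuck _ _]]; last by left; exists t.
  right; rewrite big_ord_recr /=; move: st IH.
  by move: (\sum_(i < t) _)%N (nat_of_bool (starts t)) => S b; lia.
- by right; case: run => -> _; rewrite load_init.
- by left.
Qed.

Lemma execution_terminates : exists T, terminated alpha (sigma T).
Proof.
(* One step beyond four times the bound on requests, the time inequality fails and the run must be
   stuck. *)
have [[T stuck]|] := execution_load (4 * (#|Client| * (#|Relay| * cap))).+1.
  by have [r inv _] := execution_invariant T; exists T; exact: stuck_terminated inv stuck.
by have := execution_starts_le (4 * (#|Client| * (#|Relay| * cap))).+1; lia.
Qed.

End Execution.

Lemma capE : cap%:Z = #|Relay|%:Z * Num.ceil (spread alpha / eps).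
Proof.
(* The absolute value in [cap] is harmless: the spread dominates a benefit minus itself, so it is
   nonnegative. *)
rewrite /cap PoszM gez0_abs // ceil_ge0; apply: lt_le_trans (ltrN10 _) _.
rewrite divr_ge0 ?(ltW eps_gt0) // -(subrr (alpha None None)).
exact: spread_ge.
Qed.

End Auction.

Theorem mainTheorem4 (R : realType) (Client Relay AP : finType) (M N K : nat)
    (hM : #|Client| = M) (hN : #|Relay| = N) (hK : #|AP| = K) (K_gt0 : (0 < K)%N)
    (b : option Client -> option Relay -> AP -> R) (lambda : AP -> R)
    (eps : R) (eps_gt0 : 0 < eps)
    (sigma : nat -> state R Client Relay) (starts : nat -> bool)
    (run : execution (benefit b lambda) eps sigma starts) :
  exists T : nat,
    terminated (benefit b lambda) (sigma T) /\
    (\sum_(t < T) starts t)%N%:Z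
      <= (M * N ^ 2)%N%:Z * Num.ceil (spread (benefit b lambda) / eps).
Proof.
have [T term] := execution_terminates eps_gt0 run; exists T; split=> //.
have := execution_starts_le eps_gt0 run T.
rewrite hM hN -lez_nat => /le_trans; apply.
by rewrite 2!PoszM capE // hN -mulnn !PoszM !mulrA.
Qed.
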